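(* Let $\Omega$ be a sample space, let $\mathcal{C}\subset\mathcal{P}(\Omega)$ be a field on $\Omega$, and let $P:\mathcal{C}\to\mathbb{R}$ be a price assignment. Then $P$ is system-2A-coherent if and only if $P$ is a countably additive probability.
   Context: $\mathcal{C}$ is the set of events for which prices are assigned; a price assignment is a function $P:\mathcal{C}\to\mathbb{R}$. $I_A$ denotes the indicator function of $A\subset\Omega$, and $\mathbb{Z}^{+}=\{1,2,3,\ldots\}$. A betting portfolio is a sequence $(\alpha_i,A_i)_{i\in\mathbb{Z}^{+}}$ with $\alpha_i\in\mathbb{R}$ and $A_i\in\mathcal{C}$. Its balance is $\sum_{i=1}^{\infty}\alpha_i(I_{A_i}-P(A_i))$. A betting system is a collection of betting portfolios. Betting system 2A (for given $(\Omega,\mathcal{C},P)$) consists of exactly those betting portfolios $(\alpha_i,A_i)_{i\in\mathbb{Z}^{+}}$ such that for all $w\in\Omega$, $\sum_{i=1}^{\infty}|\alpha_i(I_{A_i}(w)-P(A_i))|<\infty$. $P$ is incoherent in a given betting system if there exist a betting portfolio $(\alpha_i,A_i)_{i\in\mathbb{Z}^{+}}$ in that system and $\epsilon>0$ such that for all $w\in\Omega$, $\sum_{i=1}^{\infty}\alpha_i(I_{A_i}(w)-P(A_i))\le-\epsilon$. $P$ is coherent in the system if it is not incoherent in it; system-2A-coherent means coherent in betting system 2A. For a field $\mathcal{C}$, $P$ is a finitely additive probability if $0\le P(A)\le 1$ for all $A\in\mathcal{C}$, $P(\Omega)=1$, and $P(A\cup B)=P(A)+P(B)$ for all disjoint $A,B\in\mathcal{C}$.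 $P$ is a countably additive probability if in addition, for every sequence $(A_i)_{i\ge1}$ of disjoint sets in $\mathcal{C}$ with $\bigcup_{i\ge1}A_i\in\mathcal{C}$, $P(\bigcup_{i\ge1}A_i)=\sum_{i=1}^{\infty}P(A_i)$. *)

(* Defs.v *)
From mathcomp Require Import all_boot all_order all_algebra.
From mathcomp Require Import all_classical all_reals all_analysis.
Import Order.TTheory GRing.Theory Num.Theory.
Import numFieldNormedType.Exports.

Set Implicit Arguments.
Unset Strict Implicit.
Unset Printing Implicit Defensive.

Local Open Scope classical_set_scope.
Local Open Scope ring_scope.

(* As for the measures of the library, a price assignment on C is a total
   function [P : set Omega -> R]; only its values on C are ever used.
   Sequences are indexed by nat, i.e. the index i stands for i + 1. *)

Definition set_field (Omega : Type) (C : set (set Omega)) : Prop :=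
  [/\ C setT, setC_closed C & setU_closed C].

Record portfolio (R : realType) (Omega : Type) (C : set (set Omega)) :=
  Portfolio {
    stake : nat -> R ;
    event : nat -> set Omega ;
    event_in : forall i, C (event i) }.

Section Betting.
Context {R : realType} {Omega : Type} {C : set (set Omega)}.
Implicit Types (P : set Omega -> R) (b : portfolio R C).

Definition gain P b (w : Omega) (i : nat) : R :=
  stake b i * (\1_(event b i) w - P (event b i)).

(* [limn] is a junk value when the series diverges; this cannot happen for
   the portfolios of [system2A], whose balance converges absolutely. *)
Definition balance P b (w : Omega) : R := limn (series (gain P b w)).

Definition system2A P : set (portfolio R C) :=
  [set b | forall w, (\sum_(i <oo) `|gain P b w i|%:E < +oo)%E].

Definition incoherent P (S : set (portfolio R C)) : Prop :=
  exists b, S b /\ exists e : R, 0 < e /\ forall w, balance P b w <= - e.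

Definition coherent P (S : set (portfolio R C)) : Prop := ~ incoherent P S.

End Betting.

Definition system2A_coherent (R : realType) (Omega : Type)
    (C : set (set Omega)) (P : set Omega -> R) : Prop :=
  coherent P (system2A (C := C) P).

Definition finitely_additive_probability (R : realType) (Omega : Type)
    (C : set (set Omega)) (P : set Omega -> R) : Prop :=
  [/\ forall A, C A -> 0 <= P A <= 1,
      P setT = 1 &
      forall A B, C A -> C B -> A `&` B = set0 -> P (A `|` B) = P A + P B].

Definition countably_additive_probability (R : realType) (Omega : Type)
    (C : set (set Omega)) (P : set Omega -> R) : Prop :=
  finitely_additive_probability C P /\
  forall A : nat -> set Omega,
    (forall i, C (A i)) -> trivIset setT A -> C (\bigcup_i A i) ->
    series (P \o A) @ \oo --> P (\bigcup_i A i).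

(* Main.v *)
Require Import Defs.
From mathcomp Require Import all_boot all_order all_algebra.
From mathcomp Require Import all_classical all_reals all_analysis.
From mathcomp Require Import ring lra.
Import Order.TTheory GRing.Theory Num.Theory.
Import numFieldNormedType.Exports.

Set Implicit Arguments.
Unset Strict Implicit.
Unset Printing Implicit Defensive.

Local Open Scope classical_set_scope.
Local Open Scope ring_scope.

(** Coherence is tested on portfolios whose gains are absolutely summable at
    every outcome.

    Coherent prices form a countably additive probability because each axiom,
    when violated, gives an admissible portfolio whose balance is bounded above
    by a negative constant. Finite additivity comes from unit bets on
    [A], [B] and, with the opposite sign, on their union. For countable
    additivity the bets are on the disjoint [A i] and against their union [U]:
    the indicators cancel and the balance is the constant
    [s * (P U - \sum_i P (A i))]. This portfolio is admissible, since finite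
    additivity already bounds the partial sums of the prices by 1.

    Conversely, let [P] be a countably additive probability and let
    [X i = a i * (\1_(A i) - p i)], with [p i = P (A i)], be the gains of an
    admissible portfolio. At each outcome [|X i|] is either [|a i| * p i] or
    [|a i| * (1 - p i)], hence at least half of its mean
    [2 * |a i| * p i * (1 - p i)] (lemma [abs_gain_ge]). So absolute
    convergence at a single outcome [w0] already gives a convergent series of
    the means of the [|X i|]. By Fubini the balance then has mean zero and
    cannot be at most [-e] everywhere.

    No extension of [P] to a sigma-field is needed to run this last step. For
    [N] large, the step functions
    [\sum_(i < N) X i - \sum_(N <= i < n) |X i|] decrease in [n], have mean
    at least [- e / 8], and at every outcome fall below [- e / 2] eventually.
    This contradicts monotone convergence for step functions
    ([mean_decreasing]), which rests on continuity of [P] along increasing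
    events ([prob_nondecreasing_cvg1]) and on monotonicity of the finitely
    additive mean ([mean_on_le]). *)

(** * Real series *)

Section Series.
Context {R : realType}.

Lemma series_tail_le (u : nat -> R) dl : (forall i, 0 <= u i) ->
  cvgn (series u) -> 0 < dl ->
  exists N, forall n, (N <= n)%N -> \sum_(N <= i < n) u i <= dl.
Proof.
move=> u0 cu dl0; have ndu := nondecreasing_series (fun i _ _ => u0 i) (P := xpredT) (m := 0).
have /(@cvgr_gt R) /(_ (limn (series u) - dl)) : series u n @[n --> \oo] --> limn (series u) by [].
rewrite gtrBl => /(_ dl0)[N _ /(_ N (leqnn N)) /= Nlt]; exists N => n Nn.
have : series u n <= limn (series u) by exact: nondecreasing_cvgn_le.
rewrite /series /= (big_cat_nat _ Nn) //= in Nlt *.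
by lra.
Qed.

Lemma series_recl_cvg (u : nat -> R) l :
  series (fun i => u i.+1) n @[n --> \oo] --> l ->
  series u n @[n --> \oo] --> u 0 + l.
Proof.
move=> ul; rewrite -cvg_shiftS.
rewrite (_ : (fun n => _) = fun n => u 0 + series (fun i => u i.+1) n).
  by apply: cvgD => //; exact: cvg_cst.
by apply/funext => n; rewrite /series /= big_nat_recl.
Qed.

Lemma series_indic_trivIset (Omega : Type) (A : nat -> set Omega) w : trivIset setT A ->
  series (fun i => \1_(A i) w) n @[n --> \oo] --> (\1_(\bigcup_i A i) w : R).
Proof.
move=> tA.
have fin : (\sum_(i <oo) (\1_(A i) w : R)%:E < +oo)%E by rewrite -indic_bigcup // ltry.
have cA : cvgn (series (fun i => \1_(A i) w : R)).
  by apply: nnseries_is_cvg => // i; rewrite indicE.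
rewrite (_ : \1_(\bigcup_i A i) w = limn (series (fun i => \1_(A i) w : R))) //.
apply: EFin_inj; rewrite indic_bigcup // -EFin_lim //; congr (limn _).
by apply/funext => n; rewrite /series /= sumEFin.
Qed.

End Series.

(** * Finitely additive probabilities and means of step functions *)

Section FinitelyAdditive.
Context {R : realType} {Omega : Type} {C : set (set Omega)}.
Hypothesis fieldC : set_field C.

Lemma field_setT : C setT. Proof. by case: fieldC. Qed.

Lemma field_setC A : C A -> C (~` A). Proof. by case: fieldC => _ + _; apply. Qed.

Lemma field_setU A B : C A -> C B -> C (A `|` B).
Proof. by case: fieldC => _ _; apply. Qed.

Lemma field_set0 : C set0.
Proof. by rewrite -setCT; exact/field_setC/field_setT. Qed.

Lemma field_setI A B : C A -> C B -> C (A `&` B).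
Proof.
move=> CA CB; rewrite -[A `&` B]setCK setCI.
by apply/field_setC/field_setU; exact: field_setC.
Qed.

Lemma field_setD A B : C A -> C B -> C (A `\` B).
Proof. by move=> CA CB; rewrite setDE; apply/field_setI/field_setC. Qed.

(** As in [mean_on_le] below, membership of [w] in the last event [A n] only
    shifts the bound [c], which reduces the set to two shorter ones. *)
Lemma field_simple_le (A : nat -> set Omega) (b d : nat -> R) n (c : R) :
  (forall i, C (A i)) ->
  C [set w | \sum_(0 <= i < n) (b i * \1_(A i) w + d i) <= c].
Proof.
move=> CA; elim: n c => [|n IHn] c.
  have [c0|c0] := boolP (0 <= c).
    rewrite (_ : [set w | _] = setT); first exact: field_setT.
    by apply/seteqP; split => w //= _; rewrite big_geq.
  rewrite (_ : [set w | _] = set0); first exact: field_set0.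
  by apply/seteqP; split => w //=; rewrite big_geq // (negbTE c0).
rewrite (_ : [set w | _] =
    A n `&` [set w | \sum_(0 <= i < n) (b i * \1_(A i) w + d i) <= c - b n - d n]
    `|` ~` A n `&` [set w | \sum_(0 <= i < n) (b i * \1_(A i) w + d i) <= c - d n]).
  by apply: field_setU; apply: field_setI => //; exact: field_setC.
apply/seteqP; split => w /=; rewrite big_nat_recr //= indicE.
  have [Aw|Aw] := pselect (A n w).
    by rewrite mem_set //= => ?; left; split => //; lra.
  by rewrite memNset //= => ?; right; split => //; lra.
by case=> -[Aw]; [rewrite mem_set //=|rewrite memNset //=] => ?; lra.
Qed.

Variable P : set Omega -> R.
Hypothesis faP : finitely_additive_probability C P.

Lemma prob_ge0 A : C A -> 0 <= P A.
Proof. by case: faP => + _ _ => /[apply] /andP[]. Qed.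

Lemma prob_le1 A : C A -> P A <= 1.
Proof. by case: faP => + _ _ => /[apply] /andP[]. Qed.

Lemma prob_setT : P setT = 1. Proof. by case: faP. Qed.

Lemma probU A B : C A -> C B -> A `&` B = set0 -> P (A `|` B) = P A + P B.
Proof. by case: faP => _ _; apply. Qed.

Lemma prob_set0 : P set0 = 0.
Proof.
have := probU field_set0 field_set0 (setI0 _); rewrite setU0 => ?; lra.
Qed.

Lemma prob_setID A B : C A -> C B -> P B = P (B `&` A) + P (B `\` A).
Proof.
move=> CA CB; rewrite -probU ?setUIDK //; first exact: field_setI.
- exact: field_setD.
- by rewrite setDE setIACA setICr setI0.
Qed.

Lemma prob_setC A : C A -> P (~` A) = 1 - P A.
Proof.
move=> CA; have := prob_setID CA field_setT.
by rewrite prob_setT setTI setTD => ?; lra.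
Qed.

(** Cutting [B] along the last event [A n] makes that event constant on both
    pieces, so the bound [k] is merely shifted there and the claim is inherited
    from the shorter sum; this replaces the common refinement of the [A i] by
    atoms. Restricting to an event [B] is what makes the induction go through. *)
Lemma mean_on_le (A : nat -> set Omega) (b d : nat -> R) n B (k : R) :
  (forall i, C (A i)) -> C B ->
  (forall w, B w -> \sum_(0 <= i < n) (b i * \1_(A i) w + d i) <= k) ->
  \sum_(0 <= i < n) (b i * P (B `&` A i) + d i * P B) <= k * P B.
Proof.
move=> CA; elim: n B k => [|n IHn] B k CB ubk.
  rewrite big_geq //; have [->|/set0P[w Bw]] := eqVneq B set0.
    by rewrite prob_set0 mulr0.
  by rewrite mulr_ge0 ?prob_ge0 //; have := ubk w Bw; rewrite big_geq.
have CBA := field_setI CB (CA n); have CBD := field_setD CB (CA n).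
have /(IHn _ _ CBA) lein : forall w, (B `&` A n) w ->
    \sum_(0 <= i < n) (b i * \1_(A i) w + d i) <= k - b n - d n.
  move=> w [Bw Aw]; have := ubk w Bw.
  by rewrite big_nat_recr //= (indicE _ (A n)) mem_set //= => ?; lra.
have /(IHn _ _ CBD) leout : forall w, (B `\` A n) w ->
    \sum_(0 <= i < n) (b i * \1_(A i) w + d i) <= k - d n.
  move=> w [Bw Aw]; have := ubk w Bw.
  by rewrite big_nat_recr //= (indicE _ (A n)) memNset //= => ?; lra.
rewrite big_nat_recr //=.
have -> : \sum_(0 <= i < n) (b i * P (B `&` A i) + d i * P B) =
    \sum_(0 <= i < n) (b i * P (B `&` A n `&` A i) + d i * P (B `&` A n)) +
    \sum_(0 <= i < n) (b i * P ((B `\` A n) `&` A i) + d i * P (B `\` A n)).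
  rewrite -big_split /=; apply: eq_bigr => i _.
  have CBi := field_setI CB (CA i).
  rewrite (prob_setID (CA n) CBi) (prob_setID (CA n) CB).
  by rewrite setIAC (_ : (B `\` A n) `&` A i = (B `&` A i) `\` A n);
    [ring|rewrite !setDE setIAC].
have := prob_setID (CA n) CB.
move: (P B) (P (B `&` A n)) (P (B `\` A n)) lein leout => x y z lein leout ->.
lra.
Qed.

Lemma mean_le (A : nat -> set Omega) (b d : nat -> R) n (k : R) :
  (forall i, C (A i)) ->
  (forall w, \sum_(0 <= i < n) (b i * \1_(A i) w + d i) <= k) ->
  \sum_(0 <= i < n) (b i * P (A i) + d i) <= k.
Proof.
move=> CA ubk; have := mean_on_le CA field_setT (fun w _ => ubk w).
rewrite prob_setT mulr1; apply: le_trans.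
by under [leRHS]eq_bigr do rewrite setTI mulr1.
Qed.

End FinitelyAdditive.

(** * Countable additivity *)

Section CountablyAdditive.
Context {R : realType} {Omega : Type} {C : set (set Omega)} {P : set Omega -> R}.
Hypothesis fieldC : set_field C.
Hypothesis caP : countably_additive_probability C P.

Let faP : finitely_additive_probability C P := caP.1.

(** The increments of [F] partition the whole space, and their probabilities
    telescope to [P (F n)]. *)
Lemma prob_nondecreasing_cvg1 (F : nat -> set Omega) :
  (forall n, C (F n)) -> nondecreasing_seq F -> \bigcup_n F n = setT ->
  P (F n) @[n --> \oo] --> (1 : R).
Proof.
move=> CF ndF FT.
have CD i : C (seqD F i) by case: i => [|i] //=; exact: field_setD.
have CU : C (\bigcup_i seqD F i).
  by rewrite eq_bigcup_seqD FT; exact: field_setT.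
have := caP.2 _ CD (trivIset_seqD ndF) CU.
rewrite eq_bigcup_seqD FT (prob_setT faP) -cvg_shiftS.
apply: cvg_trans; apply: near_eq_cvg; apply: nearW => n /=.
elim: n => [|m IHm]; first by rewrite /series /= big_nat1.
rewrite /series /= big_nat_recr //= -[X in X + _]/(series (P \o seqD F) m.+1).
rewrite IHm [in RHS](setU_seqD ndF) (probU faP) //.
by rewrite /= setDE setICA setICr setI0.
Qed.

(** Monotone convergence for step functions that decrease from rank [N] on.
    Once the event that the [n]-th partial sum is at most [t] has probability
    close to 1, the mean is at most [t] up to the contribution of the
    complement, where the partial sum stays below a constant independent of
    [n]. *)
Lemma mean_decreasing (A : nat -> set Omega) (b d : nat -> R) N (t dl : R) :
  (forall i, C (A i)) ->
  (forall i w, (N <= i)%N -> b i * \1_(A i) w + d i <= 0) ->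
  (forall w, exists2 n, (N <= n)%N &
    \sum_(0 <= i < n) (b i * \1_(A i) w + d i) <= t) ->
  0 < dl ->
  exists2 n, (N <= n)%N & \sum_(0 <= i < n) (b i * P (A i) + d i) <= t + dl.
Proof.
move=> CA neg below dl0.
pose U n w := \sum_(0 <= i < n) (b i * \1_(A i) w + d i).
have Uni w m n : (N <= m <= n)%N -> U n w <= U m w.
  move=> /andP[Nm mn]; rewrite /U (big_cat_nat _ mn) //= gerDl.
  rewrite big_nat_cond; apply: sumr_le0 => i /andP[/andP[mi _] _].
  by apply: neg; exact: leq_trans mi.
pose F n := [set w | U (n + N)%N w <= t].
have CF n : C (F n) by exact: field_simple_le.
have ndF : nondecreasing_seq F.
  move=> m n mn; apply/subsetPset => w /=; apply: le_trans; apply: Uni.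
  by rewrite leq_addl leq_add2r.
have FT : \bigcup_n F n = setT.
  apply/seteqP; split=> // w _; have [n Nn Un] := below w.
  by exists (n - N)%N => //=; rewrite /F /= subnK.
pose K := \sum_(0 <= i < N) (`|b i| + `|d i|).
have UK n w : U (n + N)%N w <= K.
  apply: (le_trans (Uni w N _ _)); first by rewrite leqnn leq_addl.
  apply: ler_sum => i _; apply: lerD; last exact: ler_norm.
  rewrite (le_trans (ler_norm _)) // normrM ler_piMr // indicE.
  by case: (_ \in _); rewrite ?normr1 ?normr0.
have : (K - t) * (1 - P (F n)) @[n --> \oo] --> (K - t) * (1 - 1).
  by apply: cvgMr; apply: cvgB; [exact: cvg_cst|exact: prob_nondecreasing_cvg1].
rewrite subrr mulr0 => /(@cvgr_lt R) /(_ dl dl0)[n _ /(_ n (leqnn n)) /= small].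
exists (n + N)%N; first exact: leq_addl.
have CFC := field_setC fieldC (CF n).
have := mean_on_le fieldC faP (b := b) (d := d) (n := n + N) (k := t) CA (CF n) (fun w h => h).
have := mean_on_le fieldC faP (b := b) (d := d) (n := n + N) (k := K) CA CFC (fun w _ => UK n w).
have -> : \sum_(0 <= i < n + N) (b i * P (A i) + d i) =
  \sum_(0 <= i < n + N) (b i * P (~` F n `&` A i) + d i * P (~` F n)) +
  \sum_(0 <= i < n + N) (b i * P (F n `&` A i) + d i * P (F n)).
  rewrite -big_split /=; apply: eq_bigr => i _.
  rewrite (prob_setID fieldC faP (CF n) (CA i)) (prob_setC fieldC faP (CF n)).
  by rewrite setDE ![A i `&` _]setIC; ring.
rewrite (prob_setC fieldC faP (CF n)).
move: small; move: (P (F n)) => x; lra.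
Qed.

End CountablyAdditive.

(** * Countably additive prices are coherent *)

Section CoherenceOfProbabilities.
Context {R : realType} {Omega : Type} {C : set (set Omega)} {P : set Omega -> R}.

(** The absolute gain takes two values, so it is again affine in the indicator
    and its mean makes sense for a finitely additive probability. *)
Lemma abs_gainE (a p : R) (A : set Omega) w : 0 <= p <= 1 ->
  `|a * (\1_A w - p)| = `|a| * (1 - 2 * p) * \1_A w + `|a| * p.
Proof.
move=> /andP[p0 p1]; rewrite normrM indicE; case: (w \in A) => /=.
  by rewrite (@ger0_norm _ (1 - p)) ?subr_ge0 //; ring.
by rewrite sub0r normrN (ger0_norm p0); ring.
Qed.

(** The left-hand side is half of the mean of the absolute gain: this is what
    lets the gains at one outcome control the means. *)
Lemma abs_gain_ge (a p : R) (A : set Omega) w : 0 <= p <= 1 ->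
  `|a| * (p * (1 - p)) <= `|a * (\1_A w - p)|.
Proof.
move=> /andP[p0 p1]; rewrite normrM ler_wpM2l // indicE; case: (w \in A) => /=.
  by rewrite ger0_norm ?subr_ge0 // ler_piMl ?subr_ge0.
by rewrite sub0r normrN (ger0_norm p0) ler_piMr ?gerBl.
Qed.

Lemma probability_coherent : set_field C ->
  countably_additive_probability C P -> system2A_coherent C P.
Proof.
move=> fieldC caP [b [sumb [e [e0 bale]]]]; have faP := caP.1.
have [w0 _] : exists w : Omega, setT w.
  apply/set0P/negP => /eqP T0; have := prob_setT faP.
  by rewrite T0 (prob_set0 fieldC faP) => /eqP; rewrite eq_sym oner_eq0.
pose A := event b; pose a := stake b; pose p i := P (A i).
have CA i : C (A i) by exact: event_in.
have p01 i : 0 <= p i <= 1 by rewrite (prob_ge0 faP) ?(prob_le1 faP).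
have cgain w : cvgn (series (fun i => `|gain P b w i|)).
  by apply: nnseries_is_cvg => //; exact: sumb.
have e16 : 0 < e / 16 by rewrite divr_gt0.
have [N tailN] := series_tail_le (fun i => normr_ge0 _) (cgain w0) e16.
(* [bb i] and [dd i] are the coefficients of the gain for [i < N], and of
   minus its absolute value, by [abs_gainE], from [N] on. *)
pose bb i := if (i < N)%N then a i else - (`|a i| * (1 - 2 * p i)).
pose dd i := if (i < N)%N then - (a i * p i) else - (`|a i| * p i).
have ltN i w : (i < N)%N -> bb i * \1_(A i) w + dd i = gain P b w i.
  by rewrite /bb /dd /gain => ->; rewrite -/a -/A -/(p i); ring.
have geN i w : (N <= i)%N -> bb i * \1_(A i) w + dd i = - `|gain P b w i|.
  rewrite /bb /dd /gain ltnNge => -> /=.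
  by rewrite abs_gainE ?opprD ?mulNr //; exact: p01.
have e4 : 0 < e / 4 by rewrite divr_gt0.
have neg i w : (N <= i)%N -> bb i * \1_(A i) w + dd i <= 0.
  by move=> Ni; rewrite geN // oppr_le0.
have below w : exists2 n, (N <= n)%N &
    \sum_(0 <= i < n) (bb i * \1_(A i) w + dd i) <= - (e / 2).
  have /(@cvgr_lt R) /(_ (- (e / 2))) : series (gain P b w) n @[n --> \oo] --> balance P b w.
    by apply: normed_cvg; exact: cgain.
  case=> [|m _ mlt]; first by have := bale w; lra.
  exists (maxn N m); first exact: leq_maxl.
  apply: le_trans (ltW (mlt (maxn N m) (leq_maxr _ _))).
  rewrite /series /=; apply: ler_sum => i _.
  have [/geN ->|/ltN ->//] := leqP N i.
  by rewrite lerNl -normrN ler_norm.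
have [n Nn] := mean_decreasing fieldC caP CA neg below e4.
have -> : \sum_(0 <= i < n) (bb i * P (A i) + dd i) =
    - (2 * \sum_(N <= i < n) `|a i| * (p i * (1 - p i))).
  rewrite (big_cat_nat _ Nn) //= big1_seq ?add0r.
    rewrite mulr_sumr -sumrN; apply: eq_big_nat => i /andP[Ni _].
    by rewrite /bb /dd ltnNge Ni /= -/(p i); ring.
  by move=> i; rewrite mem_index_iota /bb /dd => /andP[_ /= ->]; rewrite -/(p i) subrr.
(* The tail bound [e / 16] makes the mean at least [- e / 8], whereas
   [mean_decreasing] puts it at most at [- e / 2 + e / 4]. *)
have := tailN n Nn.
have : \sum_(N <= i < n) `|a i| * (p i * (1 - p i)) <=
       \sum_(N <= i < n) `|gain P b w0 i|.
  by apply: ler_sum => i _; exact: abs_gain_ge.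
by lra.
Qed.

End CoherenceOfProbabilities.

(** * Coherent prices are countably additive *)

Section ProbabilityOfCoherence.
Context {R : realType} {Omega : Type} {C : set (set Omega)} {P : set Omega -> R}.
Hypothesis fieldC : set_field C.
Hypothesis cohP : system2A_coherent C P.

Lemma summable_gain (b : portfolio R C) w :
  cvgn (series (fun i => `|gain P b w i|)) ->
  (\sum_(i <oo) `|gain P b w i|%:E < +oo)%E.
Proof.
move=> cg.
rewrite (_ : (fun n => _) = EFin \o series (fun i => `|gain P b w i|)).
  by rewrite EFin_lim // ltry.
by apply/funext => n; rewrite /series /= sumEFin.
Qed.

(** Coherence as an inequality: a uniform upper bound of an admissible balance
    is nonnegative. Each axiom of probability is an instance of it. *)
Lemma coherent_bet_ge0 (a : nat -> R) (A : nat -> set Omega) (k : R) :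
  (forall i, C (A i)) ->
  (forall w, cvgn (series (fun i => `|a i * (\1_(A i) w - P (A i))|))) ->
  (forall w, limn (series (fun i => a i * (\1_(A i) w - P (A i)))) <= k) ->
  0 <= k.
Proof.
move=> CA cvga lek; rewrite leNgt; apply/negP => k0; apply: cohP.
exists (Portfolio a CA); split=> [w|]; first by apply: (@summable_gain (Portfolio a CA)); exact: cvga.
by exists (- k); rewrite oppr_gt0 k0; split => // w; rewrite opprK; exact: lek.
Qed.

(** A portfolio is an infinite sequence; zero stakes from rank [n] on make it a
    finite bet, for which summability is automatic. *)
Lemma coherent_finite_bet_ge0 n (a : nat -> R) (A : nat -> set Omega) (k : R) :
  (forall i, C (A i)) -> (forall i, (n <= i)%N -> a i = 0) ->
  (forall w, \sum_(0 <= i < n) a i * (\1_(A i) w - P (A i)) <= k) ->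
  0 <= k.
Proof.
move=> CA a0 lek.
have stat (f : nat -> R) : (forall i, (n <= i)%N -> f i = 0) ->
    \forall m \near \oo, series f m = \sum_(0 <= i < n) f i.
  move=> f0; near=> m; rewrite /series /= (@big_cat_nat _ _ _ n) //=; last by near: m; exact: nbhs_infty_ge.
  rewrite [X in _ + X]big1_seq ?addr0 // => i; rewrite mem_index_iota.
  by case/and3P => _ ni _; exact: f0.
apply: (coherent_bet_ge0 CA (a := a)) => w.
  apply: is_cvg_near_cst; apply: stat => i /a0 ->.
  by rewrite mul0r normr0.
by rewrite (norm_lim_near_cst (stat _ _)) // => i /a0 ->; rewrite mul0r.
Unshelve. all: by end_near. Qed.

Lemma coherent_finitely_additive : finitely_additive_probability C P.
Proof.
have bet1 (s k : R) A : C A -> (forall w, s * (\1_A w - P A) <= k) -> 0 <= k.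
  move=> CA lek; apply: (@coherent_finite_bet_ge0 1 (nth 0 [:: s]) (fun=> A)) => //.
    by case=> [|[]].
  by move=> w; rewrite big_nat1; exact: lek.
have bet3 (s k : R) A B : C A -> C B ->
    (forall w, s * (\1_A w - P A) + s * (\1_B w - P B)
               - s * (\1_(A `|` B) w - P (A `|` B)) <= k) -> 0 <= k.
  move=> CA CB lek.
  apply: (@coherent_finite_bet_ge0 3 (nth 0 [:: s; s; - s])
                                     (nth setT [:: A; B; A `|` B])).
  - case=> [|[|[|i]]] //=; first exact: field_setU.
    by rewrite nth_nil; exact: field_setT.
  - by case=> [|[|[|[]]]].
  - by move=> w; rewrite !big_nat_recr //= big_geq // add0r mulNr; exact: lek.
have ind01 (A : set Omega) w : 0 <= (\1_A w : R) <= 1.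
  by rewrite indicE; case: (_ \in _); rewrite /= ?lexx ?ler01.
split=> [A CA||A B CA CB AB0].
- apply/andP; split.
    by apply: (bet1 (-1) _ A) => // w; have := ind01 A w; lra.
  by rewrite -subr_ge0; apply: (bet1 1 _ A) => // w; have := ind01 A w; lra.
- apply/le_anti/andP; split; rewrite -subr_ge0.
    apply: (bet1 1 _ setT) => [|w]; first exact: field_setT.
    by rewrite indicT /=; lra.
  apply: (bet1 (-1) _ setT) => [|w]; first exact: field_setT.
  by rewrite indicT /=; lra.
- have indU w : \1_(A `|` B) w = \1_A w + \1_B w :> R.
    rewrite /indic in_setU.
    have [/set_mem Aw|] := boolP (w \in A); have [/set_mem Bw|] := boolP (w \in B); rewrite /= ?addr0 ?add0r //.
    by have : set0 w by rewrite -AB0.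
  apply/le_anti/andP; split; rewrite -subr_ge0.
    by apply: (bet3 (-1) _ A B) => // w; rewrite indU; lra.
  by apply: (bet3 1 _ A B) => // w; rewrite indU; lra.
Qed.

Lemma coherent_countably_additive : countably_additive_probability C P.
Proof.
have faP := coherent_finitely_additive; split=> // A CA tA CU.
set U := \bigcup_i A i in CU *.
have cI w := @series_indic_trivIset R Omega A w tA.
have indge0 (B : set Omega) w : 0 <= \1_B w :> R by rewrite indicE.
(* Disjointness bounds the partial sums of the indicators by 1, hence also
   their means, the partial sums of the prices. *)
have cP : cvgn (series (P \o A)).
  apply: nondecreasing_is_cvgn.
    by apply: nondecreasing_series => i _ _; exact: (prob_ge0 faP).
  exists 1 => _ [n _ <-].
  have := @mean_le _ _ _ fieldC _ faP A (fun=> 1) (fun=> 0) n 1 CA.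
  rewrite /series /=; under eq_bigr do rewrite mul1r addr0; apply => w.
  under eq_bigr do rewrite mul1r addr0.
  apply: (@le_trans _ _ (\1_U w)); last by rewrite indicE; case: (_ \in _) => //=; rewrite ler01.
  rewrite -[leLHS]/(series (fun i => \1_(A i) w) n) -(cvg_lim (@Rhausdorff R) (cI w)).
  apply: nondecreasing_cvgn_le; last by apply/cvg_ex; exists (\1_U w); exact: cI.
  by apply: nondecreasing_series => i _ _; exact: indge0.
have bet (s k : R) : s * (P U - limn (series (P \o A))) = k -> 0 <= k.
  move=> sk.
  (* Index 0 is the bet against the union, index [j.+1] the bet on [A j]. *)
  pose a i := if i is _.+1 then s else - s; pose E i := if i is j.+1 then A j else U.
  have CE i : C (E i) by case: i.
  apply: (coherent_bet_ge0 (a := a) CE) => w.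
    have cabs : cvgn (series (fun i => `|a i.+1 * (\1_(E i.+1) w - P (E i.+1))|)).
      apply: (@series_le_cvg _ _ (`|s| *: ((fun i => \1_(A i) w) + (P \o A)))) => [//|i|i|].
      - by rewrite mulr_ge0 ?addr_ge0 ?(prob_ge0 faP).
      - rewrite normrM ler_wpM2l // (le_trans (ler_normB _ _)) //.
        by rewrite !ger0_norm ?(prob_ge0 faP).
      - apply: is_cvg_seriesZ; apply: is_cvg_seriesD => //.
        by apply/cvg_ex; exists (\1_U w); exact: cI.
    by apply/cvg_ex; eexists; exact: series_recl_cvg cabs.
  suff lims : series (fun i => a i * (\1_(E i) w - P (E i))) n @[n --> \oo] --> k.
    by rewrite (cvg_lim (@Rhausdorff R) lims).
  have -> : k = - s * (\1_U w - P U) + s * (\1_U w - limn (series (P \o A))).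
    by rewrite -sk; ring.
  apply: (@series_recl_cvg R (fun i => a i * (\1_(E i) w - P (E i)))) => /=.
  rewrite (_ : series _ = fun n => s * (series (fun i => \1_(A i) w) n - series (P \o A) n)).
    by apply: cvgMr; apply: cvgB => //; exact: cI.
  by apply/funext => n; rewrite /series /= -sumrB mulr_sumr.
suff : P U = limn (series (P \o A)) by move=> ->.
apply/le_anti/andP; split; rewrite -subr_ge0.
  by apply: (bet (-1)); lra.
by apply: (bet 1); lra.
Qed.

End ProbabilityOfCoherence.

Theorem theorem4 (R : realType) (Omega : Type) (C : set (set Omega))
    (P : set Omega -> R) (hC : set_field C) :
  system2A_coherent C P <-> countably_additive_probability C P.
Proof.
by split; [exact: coherent_countably_additive|exact: probability_coherent].
Qed.
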